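(* Let $B$ be a topological space and let $f,g:X\to Y$ be fibrewise maps between fibrewise spaces over $B$. (1) If $h:Y\to Z$ is a fibrewise map, then $D_B(h\circ f,h\circ g)\le D_B(f,g)$. (2) If $k:Z\to X$ is a fibrewise map, then $D_B(f\circ k,g\circ k)\le D_B(f,g)$.
   Context: Fix a topological space $B$ and let $I=[0,1]$. A fibrewise space over $B$ is a topological space $X$ with a continuous map $p_X:X\to B$; a fibrewise map $f:X\to Y$ is a continuous map with $p_Y\circ f=p_X$. A subspace $U\subset X$ is a fibrewise space via $p_X|_U$. Two fibrewise maps $f,g:X\to Y$ are fibrewise homotopic, $f\simeq_B g$, if there is a continuous $H:X\times I\to Y$ with $H(x,0)=f(x)$, $H(x,1)=g(x)$ and $p_Y(H(x,t))=p_X(x)$ for all $x,t$. Parametrized homotopic distance: for fibrewise maps $f,g:X\to Y$, $D_B(f,g)$ is the smallest integer $n\ge 0$ such that $X$ has an open cover $\{U_0,\dots,U_n\}$ with $f|_{U_i}\simeq_B g|_{U_i}$ for all $i$; it is $\infty$ if no such $n$ exists. *)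

(* Defs.v *)
From HB Require Import structures.
From mathcomp Require Import all_boot all_order all_algebra.
From mathcomp Require Import all_classical all_reals topology.

Import numFieldTopology.Exports.

Set Implicit Arguments.
Unset Strict Implicit.
Unset Printing Implicit Defensive.

Local Open Scope classical_set_scope.
Local Open Scope ring_scope.

Record fibrewise_space (B : topologicalType) := FibrewiseSpace {
  total_space :> topologicalType;
  proj : total_space -> B;
  proj_continuous : continuous proj }.

Record fibrewise_map (B : topologicalType) (X Y : fibrewise_space B) :=
  FibrewiseMap {
    fib_fun :> X -> Y;
    fib_fun_continuous : continuous fib_fun;
    proj_fib_fun : @proj B Y \o fib_fun = @proj B X }.

Section fibrewise_comp.
Variables (B : topologicalType) (X Y Z : fibrewise_space B).
Variables (h : fibrewise_map Y Z) (f : fibrewise_map X Y).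

Lemma fib_comp_continuous : continuous (h \o f).
Proof.
by move=> x; apply: continuous_comp; apply: fib_fun_continuous.
Qed.

Lemma proj_fib_comp : @proj B Z \o (h \o f) = @proj B X.
Proof. by rewrite compA !proj_fib_fun. Qed.

Definition fib_comp : fibrewise_map X Z :=
  FibrewiseMap fib_comp_continuous proj_fib_comp.

End fibrewise_comp.

Section fibrewise_subspace.
Variables (B : topologicalType) (X : fibrewise_space B) (U : set X).

Lemma proj_sub_continuous :
  continuous (@proj B X \o (set_val : set_type U -> X)).
Proof.
move=> x; apply: continuous_comp; last exact: proj_continuous.
exact: initial_continuous.
Qed.

(* [set_type U] carries the subspace topology, i.e. the initial topology of
   the inclusion [set_val]. *)
Definition fib_sub : fibrewise_space B := FibrewiseSpace proj_sub_continuous.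

Definition fib_incl : fibrewise_map fib_sub X :=
  @FibrewiseMap B fib_sub X set_val (@initial_continuous _ _ _) erefl.

Definition fib_restrict (Y : fibrewise_space B) (f : fibrewise_map X Y) :
  fibrewise_map fib_sub Y := fib_comp f fib_incl.

End fibrewise_subspace.

Definition unit_interval (R : realType) : topologicalType :=
  set_type `[0 : R, 1]%classic.

Definition fibrewise_homotopic (R : realType) (B : topologicalType)
    (X Y : fibrewise_space B) (f g : fibrewise_map X Y) : Prop :=
  exists H : X * unit_interval R -> Y,
    [/\ continuous H,
        forall x (t : unit_interval R), set_val t = 0 -> H (x, t) = f x,
        forall x (t : unit_interval R), set_val t = 1 -> H (x, t) = g x &
        forall x t, proj (H (x, t)) = proj x].

Definition homotopic_cover (R : realType) (B : topologicalType)
    (X Y : fibrewise_space B) (f g : fibrewise_map X Y) (n : nat) : Prop :=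
  exists U : 'I_n.+1 -> set X,
    [/\ forall i, open (U i),
        \bigcup_i U i = [set: X] &
        forall i, fibrewise_homotopic R
          (fib_restrict (U i) f) (fib_restrict (U i) g)].

(* D_B(f, g); extended integers are used to accommodate the value +oo, all
   finite values being natural numbers. *)
Definition homotopic_distance (R : realType) (B : topologicalType)
    (X Y : fibrewise_space B) (f g : fibrewise_map X Y) : \bar int :=
  if pselect (exists n, `[< homotopic_cover R f g n >]) is left ex_n
  then ((ex_minn ex_n)%:Z)%:E else +oo%E.

(* Main.v *)
Require Import Defs.
From mathcomp Require Import all_boot all_order all_algebra.
From mathcomp Require Import all_classical all_reals topology.

(** Both inequalities hold because composition on either side transports
    open covers with homotopies on their members, without changing the number of
    open sets.
    Postcomposing a fibrewise homotopy with [h] is again a fibrewise homotopy,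
    so a cover of [X] that is good for [f, g] is also good for [h f, h g]
    ([homotopic_cover_compl]).  If [U_i] is such a cover of [X] and [k : Z -> X],
    then the open sets [k @^-1` U_i] cover [Z], [k] restricts to
    [k @^-1` U_i -> U_i], and precomposing the homotopy on [U_i] with this
    restriction gives one on [k @^-1` U_i] ([homotopic_cover_compr]).
    Such a transport of covers, size by size, is exactly what is needed to
    compare the least sizes ([le_homotopic_distance]). *)

Set Implicit Arguments.
Unset Strict Implicit.
Unset Printing Implicit Defensive.

Local Open Scope classical_set_scope.

(** An infinite right-hand side bounds everything; a finite one is attained by
    a cover, whose transport bounds the minimum on the left. *)
Lemma le_homotopic_distance (R : realType) (B : topologicalType)
    (X Y X' Y' : fibrewise_space B) (f g : fibrewise_map X Y)
    (f' g' : fibrewise_map X' Y') :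
  (forall n, homotopic_cover R f g n -> homotopic_cover R f' g' n) ->
  (homotopic_distance R f' g' <= homotopic_distance R f g)%E.
Proof.
move=> fg_fg'; rewrite /homotopic_distance.
case: pselect => [ex_fg'|no_fg']; case: pselect => [ex_fg|_];
  rewrite ?leey //.
  rewrite lee_fin; case: (ex_minnP ex_fg) => n /asboolP /fg_fg' cov_n _.
  by case: ex_minnP => m _; apply; apply/asboolP.
have [n /asboolP /fg_fg' cov_n] := ex_fg.
by case: no_fg'; exists n; apply/asboolP.
Qed.

Lemma fibrewise_homotopic_compl (R : realType) (B : topologicalType)
    (X Y Z : fibrewise_space B) (f g : fibrewise_map X Y)
    (h : fibrewise_map Y Z) :
  fibrewise_homotopic R f g ->
  fibrewise_homotopic R (fib_comp h f) (fib_comp h g).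
Proof.
move=> [H [ctsH H0 H1 projH]]; exists (h \o H); split.
- by move=> u; apply: continuous_comp; [exact: ctsH|exact: fib_fun_continuous].
- by move=> x t t0 /=; rewrite H0.
- by move=> x t t1 /=; rewrite H1.
- by move=> x t; rewrite -(projH x t) -(proj_fib_fun h).
Qed.

Lemma fibrewise_homotopic_compr (R : realType) (B : topologicalType)
    (X Y Z : fibrewise_space B) (f g : fibrewise_map X Y)
    (k : fibrewise_map Z X) :
  fibrewise_homotopic R f g ->
  fibrewise_homotopic R (fib_comp f k) (fib_comp g k).
Proof.
move=> [H [ctsH H0 H1 projH]].
exists (H \o (fun u : Z * unit_interval R => (k u.1, u.2))); split.
- move=> u; apply: continuous_comp; last exact: ctsH.
  apply: (@cvg_pair _ _ _ _ (nbhs (k u.1)) (nbhs u.2)); last exact: cvg_snd.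
  by apply: continuous_comp; [exact: cvg_fst|exact: fib_fun_continuous].
- by move=> x t t0 /=; rewrite H0.
- by move=> x t t1 /=; rewrite H1.
- by move=> x t; rewrite /= projH -(proj_fib_fun k).
Qed.

Section restriction_to_preimage.
Variables (B : topologicalType) (Z X : fibrewise_space B).
Variables (k : fibrewise_map Z X) (U : set X).

Lemma mem_preimage_fib (z : set_type (k @^-1` U)) : k (set_val z) \in U.
Proof. by rewrite inE; exact: (set_valP z). Qed.

Definition preimage_fun (z : fib_sub (k @^-1` U)) : fib_sub U :=
  exist _ (k (set_val z)) (mem_preimage_fib z).

(** The target carries the initial topology of its inclusion into [X], so it
    suffices that the composite with that inclusion, which is [k] restricted to
    [k @^-1` U], is continuous. *)
Lemma preimage_fun_continuous : continuous preimage_fun.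
Proof.
apply: continuous_comp_initial.
exact: (@fib_fun_continuous _ _ _ (fib_restrict (k @^-1` U) k)).
Qed.

Lemma proj_preimage_fun :
  @Defs.proj B (fib_sub U) \o preimage_fun =
  @Defs.proj B (fib_sub (k @^-1` U)).
Proof. by rewrite /= -(proj_fib_fun k). Qed.

Definition fib_restrict_preimage :
  fibrewise_map (fib_sub (k @^-1` U)) (fib_sub U) :=
  FibrewiseMap preimage_fun_continuous proj_preimage_fun.

End restriction_to_preimage.

Lemma homotopic_cover_compl (R : realType) (B : topologicalType)
    (X Y Z : fibrewise_space B) (f g : fibrewise_map X Y)
    (h : fibrewise_map Y Z) n :
  homotopic_cover R f g n ->
  homotopic_cover R (fib_comp h f) (fib_comp h g) n.
Proof.
move=> [U [openU coverU homU]]; exists U; split => // i.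
(* Restriction to [U i] and composition with [h] commute on the nose on
   underlying functions, and homotopy only sees these. *)
exact: (fibrewise_homotopic_compl h (homU i)).
Qed.

Lemma homotopic_cover_compr (R : realType) (B : topologicalType)
    (X Y Z : fibrewise_space B) (f g : fibrewise_map X Y)
    (k : fibrewise_map Z X) n :
  homotopic_cover R f g n ->
  homotopic_cover R (fib_comp f k) (fib_comp g k) n.
Proof.
move=> [U [openU coverU homU]]; exists (fun i => k @^-1` U i); split.
- move=> i; apply: open_comp; last exact: openU.
  by move=> z _; exact: fib_fun_continuous.
- by rewrite -preimage_bigcup coverU preimage_setT.
- move=> i.
  (* The square formed by [k], its restriction to [k @^-1` U i] and the two
     inclusions commutes definitionally on underlying functions. *)
  exact: (fibrewise_homotopic_compr (fib_restrict_preimage k (U i))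
    (homU i)).
Qed.

Theorem proposition4p1 (R : realType) (B : topologicalType)
    (X Y : fibrewise_space B) (f g : fibrewise_map X Y) :
  (forall (Z : fibrewise_space B) (h : fibrewise_map Y Z),
     (homotopic_distance R (fib_comp h f) (fib_comp h g)
        <= homotopic_distance R f g)%E) /\
  (forall (Z : fibrewise_space B) (k : fibrewise_map Z X),
     (homotopic_distance R (fib_comp f k) (fib_comp g k)
        <= homotopic_distance R f g)%E).
Proof.
split=> Z k; apply: le_homotopic_distance => n.
  exact: homotopic_cover_compl.
exact: homotopic_cover_compr.
Qed.
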